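(* Let $A\in\mathbb{C}^{n\times n}$ and let $X$ be a minimal rank right weak Drazin inverse of $A$. If $Y=AXA^{\dagger}$, then $Y$ is a strong Bott–Duffin $(AXA^{\dagger}A,\;A^{2}XA^{\dagger})$-inverse of $A$.
   Context: $A^{\dagger}$ is the Moore–Penrose inverse of $A$. The index $\operatorname{ind}(A)$ is the smallest nonnegative integer $k$ such that $\operatorname{rank}(A^k)=\operatorname{rank}(A^{k+1})$. $A^{D}$ is the Drazin inverse of $A$: the unique $T$ with $TAT=T$, $AT=TA$, $A^{k+1}T=A^k$ where $k=\operatorname{ind}(A)$. A matrix $X\in\mathbb{C}^{n\times n}$ is a minimal rank right weak Drazin inverse of $A$ if $A^{k+1}X=A^{k}$ for some $k\in\mathbb{N}$ and $\operatorname{rank}(X)=\operatorname{rank}(A^{D})$. For a fixed such $X$, $AXA^{\dagger}$ is called the weak DMP inverse of $A$. Given a semigroup $S$ and idempotents $e,f\in S$, an element $y\in S$ is the strong Bott–Duffin $(e,f)$-inverse of $a\in S$ if $yay=y$, $ya=e$ and $ay=f$ (such $y$ is unique if it exists). Here $S=\mathbb{C}^{n\times n}$ under multiplication; the assertion includes that the two given matrices $e,f$ are idempotent. *)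

(* Defs.v *)
From HB Require Import structures.
From mathcomp Require Import all_boot all_order all_fingroup all_algebra.
From mathcomp Require Import complex reals.

Set Implicit Arguments.
Unset Strict Implicit.
Unset Printing Implicit Defensive.

Import Order.TTheory GRing.Theory Num.Theory.

Local Open Scope ring_scope.
Local Open Scope sesquilinear_scope.

Section MoorePenrose.
Context {C : numClosedFieldType}.

(* The four Penrose equations; M ^t* is the conjugate transpose of M. *)
Definition is_mpinv m n (A : 'M[C]_(m, n)) (P : 'M[C]_(n, m)) : bool :=
  [&& A *m P *m A == A,
      P *m A *m P == P,
      (A *m P) ^t* == A *m P &
      (P *m A) ^t* == P *m A].

Lemma trmxC_mul m n p (A : 'M[C]_(m, n)) (B : 'M[C]_(n, p)) :
  (A *m B) ^t* = B ^t* *m A ^t*.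
Proof. by rewrite trmx_mul map_mxM. Qed.

Lemma trmxC_inv n (A : 'M[C]_n) : (invmx A) ^t* = invmx (A ^t*).
Proof. by rewrite trmx_inv map_invmx. Qed.

Lemma row_free_gram_unit m n (M : 'M[C]_(m, n)) :
  row_free M -> M *m M ^t* \in unitmx.
Proof.
move=> fM; rewrite -row_free_unit -kermx_eq0; apply/rowV0P => v /sub_kermxP.
rewrite mulmxA => vM0; apply/eqP; rewrite -(mulmx_free_eq0 v fM).
apply: contraT => /dotmx_is_dotmx.
by rewrite dotmxE trmxC_mul mulmxA vM0 mul0mx mxE ltxx.
Qed.

Lemma is_mpinv_rank_factorization m n r (F : 'M[C]_(m, r)) (G : 'M[C]_(r, n))
    (H K : 'M[C]_r) :
    H *m (F ^t* *m F) = 1%:M -> G *m G ^t* *m K = 1%:M ->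
    H ^t* = H -> K ^t* = K ->
  is_mpinv (F *m G) (G ^t* *m K *m H *m F ^t*).
Proof.
move=> HF GK hH hK.
have AP : F *m G *m (G ^t* *m K *m H *m F ^t*) = F *m H *m F ^t*.
  by rewrite -!mulmxA (mulmxA G) (mulmxA (G *m _) K) GK mul1mx.
have PA : G ^t* *m K *m H *m F ^t* *m (F *m G) = G ^t* *m K *m G.
  by rewrite -!mulmxA (mulmxA (F ^t*)) (mulmxA H) HF mul1mx.
apply/and4P; split; apply/eqP.
- by rewrite AP -!mulmxA (mulmxA (F ^t*)) (mulmxA H) HF mul1mx.
- by rewrite PA -!mulmxA (mulmxA G) (mulmxA (G *m _) K) GK mul1mx.
- by rewrite AP !trmxC_mul trmxCK hH mulmxA.
- by rewrite PA !trmxC_mul trmxCK hK mulmxA.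
Qed.

Lemma is_mpinv_exists m n (A : 'M[C]_(m, n)) : exists P, is_mpinv A P.
Proof.
have uG := row_free_gram_unit (row_base_free A).
have uF : (col_base A) ^t* *m col_base A \in unitmx.
  rewrite -{2}[col_base A]trmxCK; apply: row_free_gram_unit.
  by rewrite /row_free mxrank_map mxrank_tr; exact: col_base_full.
have := is_mpinv_rank_factorization (mulVmx uF) (mulmxV uG).
rewrite mulmx_base => mpA; eexists; apply: mpA.
  by rewrite trmxC_inv trmxC_mul trmxCK.
by rewrite trmxC_inv trmxC_mul trmxCK.
Qed.

Lemma is_mpinv_unique m n (A : 'M[C]_(m, n)) P Q :
  is_mpinv A P -> is_mpinv A Q -> P = Q.
Proof.
move=> /and4P[/eqP P1 /eqP P2 /eqP P3 /eqP P4].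
move=> /and4P[/eqP Q1 /eqP Q2 /eqP Q3 /eqP Q4].
have eAP : A *m P = A *m Q.
  by rewrite -{1}Q1 -mulmxA -Q3 -P3 -trmxC_mul mulmxA P1 Q3.
have ePA : P *m A = Q *m A.
  by rewrite -{1}Q1 -mulmxA mulmxA -P4 -Q4 -trmxC_mul -mulmxA (mulmxA A) P1 Q4.
by rewrite -P2 ePA -mulmxA eAP mulmxA Q2.
Qed.

Definition mpinv m n (A : 'M[C]_(m, n)) : 'M[C]_(n, m) :=
  xchoose (is_mpinv_exists A).

Lemma mpinvP m n (A : 'M[C]_(m, n)) : is_mpinv A (mpinv A).
Proof. exact: xchooseP. Qed.

End MoorePenrose.

Section Drazin.
Context {F : fieldType} {n : nat}.
Implicit Types A T X : 'M[F]_n.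

Lemma rank_expS_leq A k : (\rank (A ^+ k.+1) <= \rank (A ^+ k))%N.
Proof. by rewrite exprS; exact: mxrankM_maxr. Qed.

Lemma ind_exists A : exists k, \rank (A ^+ k) == \rank (A ^+ k.+1).
Proof.
have [/existsP[k]|/existsPn neq] :=
  boolP [exists k : 'I_n.+1, \rank (A ^+ k) == \rank (A ^+ k.+1)].
  by exists k.
suff /(_ n.+1 (leqnn _)) : forall k, (k <= n.+1)%N -> (\rank (A ^+ k) + k <= n)%N.
  by rewrite addnS ltnNge leq_addl.
elim=> [|k IHk] lekn; first by rewrite addn0 rank_leq_row.
apply: leq_trans (IHk (ltnW lekn)); rewrite addnS ltn_add2r.
by rewrite ltn_neqAle rank_expS_leq eq_sym (neq (Ordinal lekn)).
Qed.

Definition ind A : nat := ex_minn (ind_exists A).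

Definition is_drazin A T : bool :=
  [&& T * A * T == T, A * T == T * A & A ^+ (ind A).+1 * T == A ^+ ind A].

Lemma is_drazin_exists A : exists T, is_drazin A T.
Proof.
rewrite /is_drazin; have : \rank (A ^+ ind A) = \rank (A ^+ (ind A).+1).
  by rewrite /ind; case: ex_minnP => k /eqP.
move: (ind A) => k rk.
have [M AM] : exists M, A ^+ k = M * A ^+ k.+1.
  apply/submxP; have sub : (A ^+ k.+1 <= A ^+ k)%MS by rewrite exprS submxMl.
  by rewrite -(geq_leqif (mxrank_leqif_sup sub)) rk.
have [N AN] : exists N, A ^+ k = A ^+ k.+1 * N.
  have sub : ((A ^+ k.+1)^T <= (A ^+ k)^T)%MS.
    by rewrite exprSr -mulmxE trmx_mul submxMl.
  have /submxP[D /(congr1 trmx)] : ((A ^+ k)^T <= (A ^+ k.+1)^T)%MS.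
    by rewrite -(geq_leqif (mxrank_leqif_sup sub)) !mxrank_tr rk.
  by rewrite trmx_mul !trmxK => ->; exists D^T.
have AMj j : M ^+ j * A ^+ (k + j) = A ^+ k.
  elim: j => [|j IHj]; first by rewrite addn0 mul1r.
  by rewrite exprSr -mulrA addnS -addSn exprD (mulrA M) -AM -exprD.
have ANj j : A ^+ (j + k) * N ^+ j = A ^+ k.
  elim: j => [|j IHj]; first by rewrite mulr1.
  by rewrite exprS mulrA addSn -addnS exprD -(mulrA (A ^+ j)) -AN -exprD.
pose T := A ^+ k * N ^+ k.+1.
have defT : T = M ^+ k.+1 * A ^+ k.
  by rewrite /T -{1}(AMj k.+1) -mulrA addnC ANj.
have AT : A * T = A ^+ k * N ^+ k.
  by rewrite /T mulrA -exprS (exprS N) mulrA -AN.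
have TA : T * A = M ^+ k * A ^+ k.
  by rewrite defT -mulrA -exprSr exprSr -mulrA -AM.
have cAT : A * T = T * A by rewrite AT TA -{1}(AMj k) -mulrA ANj.
exists T; apply/and3P; split; apply/eqP=> //.
  rewrite {1}defT /T -(mulrA _ _ A) -exprSr -mulrA (mulrA (A ^+ _)) -exprD.
  by rewrite ANj -defT.
have : GRing.comm T (A ^+ k.+1) by apply: commrX; rewrite /GRing.comm.
by rewrite /GRing.comm => <-; rewrite defT -mulrA -exprD AMj.
Qed.

Lemma is_drazin_unique A T U : is_drazin A T -> is_drazin A U -> T = U.
Proof.
have tele V j : V * A * V = V -> A * V = V * A ->
    V ^+ j.+1 * A ^+ j.+1 = V * A /\ A ^+ j.+1 * V ^+ j.+1 = V * A.
  move=> V1 V2; have cVA : GRing.comm V A by [].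
  rewrite -(exprMn_comm _ cVA) -(exprMn_comm _ (commr_sym cVA)) V2. suff -> : (V * A) ^+ j.+1 = V * A by [].
  by elim: j => [|j IHj] //; rewrite exprS IHj mulrA V1.
move=> /and3P[/eqP T1 /eqP T2 /eqP T3] /and3P[/eqP U1 /eqP U2 /eqP U3].
have cT : GRing.comm (A ^+ (ind A).+1) T by apply/commr_sym/commrX.
have eT : T * A = T * A * (U * A).
  have [<- _] := tele T (ind A) T1 T2.
  by rewrite -mulrA (mulrA _ U) U3 -exprSr.
have eU : U * A = T * A * (U * A).
  have [_ <-] := tele U (ind A) U1 U2.
  rewrite mulrA; congr (_ * _).
  by rewrite -mulrA (commrX _ (commr_refl A)) mulrA -cT T3 -exprSr.
have e : T * A = U * A by rewrite eT -eU.
by rewrite -T1 e -mulrA T2 e -U2 mulrA U1.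
Qed.

Definition drazin A : 'M[F]_n := xchoose (is_drazin_exists A).

Lemma drazinP A : is_drazin A (drazin A).
Proof. exact: xchooseP. Qed.

Definition is_minrank_right_weak_drazin A X : Prop :=
  (exists k : nat, A ^+ k.+1 * X = A ^+ k) /\ \rank X = \rank (drazin A).

End Drazin.

(* Idempotency of e and f is part of the assertion, not a hypothesis. *)
Definition is_strong_bott_duffin (S : Type) (op : SemiGroup.law S)
    (e f a y : S) : Prop :=
  [/\ op e e = e /\ op f f = f,
      op (op y a) y = y,
      op y a = e &
      op a y = f].

(* Main.v *)
(* If A^{k+1} X = A^k, the row space of A^k is contained in that of X; minimality of the
   rank makes them equal, so X = M A^k with k as large as desired.  Hence X A X = X,
   and X A^+ A = X because A A^+ A = A; everything else is associativity. *)
Require Import Defs.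
From HB Require Import structures.
From mathcomp Require Import all_boot all_order all_fingroup all_algebra.
From mathcomp Require Import complex reals.

Set Implicit Arguments.
Unset Strict Implicit.
Unset Printing Implicit Defensive.

Import Order.TTheory GRing.Theory Num.Theory.

Local Open Scope ring_scope.

(** Iterates [T = T A T] for [T = drazin A], which commutes with [A]; it bounds the rank of [T] by
    that of every power of [A]. *)
Lemma drazin_outer_power (F : fieldType) (n : nat) (A : 'M[F]_n) (j : nat) :
  drazin A = drazin A ^+ j.+1 * A ^+ j.
Proof.
have /and3P[/eqP TAT /eqP AT _] := drazinP A.
elim: j => [|j IHj]; first by rewrite mulr1.
rewrite exprS (exprS A) -mulrA (mulrA _ A) -(commrX j.+1 AT) -(mulrA A) -IHj.
by rewrite mulrA TAT.
Qed.

Lemma minrank_right_weak_drazin_factor (F : fieldType) (n : nat)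
    (A X : 'M[F]_n) :
  is_minrank_right_weak_drazin A X ->
  exists k M, A ^+ k.+2 * X = A ^+ k.+1 /\ X = M * A ^+ k.+1.
Proof.
move=> [[k AX] rX]; exists k.
(* The given [k] may be 0; raising the exponent by one guarantees that [X] ends in a factor [A]. *)
have AXS : A ^+ k.+2 * X = A ^+ k.+1 by rewrite exprS -mulrA AX -exprS.
have sub : (A ^+ k.+1 <= X)%MS by rewrite -AXS; exact: submxMl.
have : (X <= A ^+ k.+1)%MS.
  rewrite -(geq_leqif (mxrank_leqif_sup sub)) rX.
  by rewrite (drazin_outer_power A k.+1); exact: mxrankM_maxr.
by case/submxP => M XM; exists M.
Qed.

Lemma minrank_right_weak_drazin_outer (F : fieldType) (n : nat)
    (A X : 'M[F]_n) :
  is_minrank_right_weak_drazin A X -> X * A * X = X.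
Proof.
case/minrank_right_weak_drazin_factor => k [M [AX XM]].
by rewrite {1}XM -(mulrA M) -exprSr -mulrA AX -XM.
Qed.

Lemma minrank_right_weak_drazin_mpinvK (C : numClosedFieldType) (n : nat)
    (A X : 'M[C]_n) :
  is_minrank_right_weak_drazin A X -> X * mpinv A * A = X.
Proof.
case/minrank_right_weak_drazin_factor => k [M [_ ->]].
have /and4P[/eqP APA _ _ _] := mpinvP A; rewrite !mulmxE in APA.
(* The last factor [A] of the power absorbs [mpinv A * A]. *)
by rewrite exprSr -!mulrA (mulrA A) APA.
Qed.

Theorem proposition3p15 (R : realType) (n : nat) (A X Y : 'M[R[i]]_n)
    (hX : is_minrank_right_weak_drazin A X)
    (hY : Y = A * X * mpinv A) :
  is_strong_bott_duffin *%R
    (A * X * mpinv A * A) (A ^+ 2 * X * mpinv A) A Y.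
Proof.
have XAX := minrank_right_weak_drazin_outer hX.
have XPA := minrank_right_weak_drazin_mpinvK hX.
have YA : Y * A = A * X by rewrite hY -(mulrA A) -mulrA XPA.
have YAY : Y * A * Y = Y by rewrite YA hY !mulrA -(mulrA A) -(mulrA A) XAX.
have AY : A * Y = A ^+ 2 * X * mpinv A by rewrite hY expr2 !mulrA.
(* The prescribed idempotents are [Y * A] and [A * Y], so idempotency follows from [YAY]. *)
have YAI : Y * A * (Y * A) = Y * A by rewrite mulrA YAY.
have AYI : A * Y * (A * Y) = A * Y by rewrite -mulrA (mulrA Y) YAY.
by rewrite -AY -hY; split.
Qed.
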